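(* Let $a>0$, $\delta>0$, $p>0$ satisfy $1<p/\delta\le e$, and put $U_e=\frac{1}{a}\ln(p/\delta)$. Let $c>2\sqrt{p}$ be given. Then for all sufficiently small delays $\tau_1,\tau_2>0$ (i.e. there is $\tau^*>0$, depending on $a,\delta,p,c$, such that for all $\tau_1,\tau_2\in(0,\tau^* )$) the equation $$\frac{\partial u(t,x)}{\partial t}=\frac{\partial^2 u(t-\tau_1,x)}{\partial x^2}-\delta u(t,x)+p\,u(t-\tau_2,x)e^{-a u(t-\tau_2,x)}$$ has a traveling wave solution $u(t,x)=\phi(x+ct)$ with wave speed $c$, connecting the equilibria $0$ and $U_e$.
   Context: The equation is a diffusive Nicholson blowflies model with a delay $\tau_1$ in the diffusion term and a delay $\tau_2$ in the birth term, for real-valued $u$ with $t,x\in\mathbb{R}$. Its equilibria are $U_0=0$ and $U_e=\frac1a\ln(p/\delta)$. A traveling wave solution with speed $c>0$ connecting the two equilibria is a solution of the form $u(t,x)=\phi(x+ct)$, where the twice differentiable profile $\phi:\mathbb{R}\to\mathbb{R}$ satisfies, for all $\xi\in\mathbb{R}$, $$\phi''(\xi-c\tau_1)-c\phi'(\xi)-\delta\phi(\xi)+p\,\phi(\xi-c\tau_2)e^{-a\phi(\xi-c\tau_2)}=0,$$ together with $\lim_{\xi\to-\infty}\phi(\xi)=0$ and $\lim_{\xi\to\infty}\phi(\xi)=U_e$. With $r_1=c\tau_1$, $r_2=c\tau_2$ this is equivalent, after the shift $t=\xi-r_1$, to $\phi''(t)-c\phi'(t+r_1)-\delta\phi(t+r_1)+p\,\phi(t+r_1-r_2)e^{-a\phi(t+r_1-r_2)}=0$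 for all $t\in\mathbb{R}$. *)

(* Defs.v *)
From Stdlib Require Import Reals.
From Coquelicot Require Import Coquelicot.

Open Scope R_scope.

Definition birth (a p v : R) : R := p * v * exp (- a * v).

Definition U0 : R := 0.
Definition Ue (a delta p : R) : R := / a * ln (p / delta).

(* Differentiability of f itself must be required separately:
   [ex_derive_n f 2 x] only says that the total function [Derive f] is
   differentiable at x. *)
Definition twice_differentiable (f : R -> R) : Prop :=
  forall x : R, ex_derive f x /\ ex_derive_n f 2 x.

(* u_t(t,x) = u_xx(t - tau1,x) - delta u(t,x) + b(u(t - tau2,x)) on R x R,
   in the classical sense; the arguments of u are time, then space. *)
Definition nicholson_solution
    (a delta p tau1 tau2 : R) (u : R -> R -> R) : Prop :=
  (forall t x : R, ex_derive (fun s : R => u s x) t) /\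
  (forall t : R, twice_differentiable (fun y : R => u t y)) /\
  forall t x : R,
    Derive (fun s : R => u s x) t =
      Derive_n (fun y : R => u (t - tau1) y) 2 x
      - delta * u t x + birth a p (u (t - tau2) x).

Definition profile_equation
    (a delta p tau1 tau2 c : R) (phi : R -> R) : Prop :=
  forall xi : R,
    Derive_n phi 2 (xi - c * tau1) - c * Derive phi xi - delta * phi xi
      + birth a p (phi (xi - c * tau2)) = 0.

(* The profile equation is the PDE for u(t,x) = phi(x + c t); both are
   recorded, so that u is visibly a solution of the PDE. *)
Definition traveling_wave
    (a delta p tau1 tau2 c Uminus Uplus : R)
    (phi : R -> R) (u : R -> R -> R) : Prop :=
  0 < c /\
  (forall t x : R, u t x = phi (x + c * t)) /\
  nicholson_solution a delta p tau1 tau2 u /\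
  twice_differentiable phi /\
  profile_equation a delta p tau1 tau2 c phi /\
  is_lim phi m_infty Uminus /\
  is_lim phi p_infty Uplus.

(* Main.v *)
Require Import Defs.
From Stdlib Require Import Reals Lra.
From Coquelicot Require Import Coquelicot.

Open Scope R_scope.

(** The wave is the fixed point of an order-preserving integral operator.

    Write r1 = c tau1, r2 = c tau2, s = r1 - r2, and rescale the profile by
    U_e, so that it takes values in [0, 1] and the birth function becomes
    g x = p x exp (- l x) with l = ln (p / delta), increasing on [0, 1] because
    l <= 1.  The profile equation, read at the time of its second derivative, is
      phi'' t = c phi' (t + r1) + delta phi (t + r1) - g (phi (t + s)).
    Put m = delta / c and n = c + m.  The advanced linear part is then
    c (phi' + m phi) (t + r1), and phi'' - c phi' - m n phi factors as
    (d/dt - n) (d/dt + m) phi.  Inverting the factors by the two one-sided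
    exponential averages, [future n] and [past m], turns the equation into
    phi = T phi with T = [wave_map]:
      T phi = (past m + future n) (m^2 phi + g (phi (. + s))) / (m + n)
              + c (future n phi - future n phi (. + r1)).
    The last difference is the only term that could destroy monotonicity of T,
    and for small r1 it is absorbed by the m^2 term ([wave_kernel_nonneg]).  The
    choice c m = delta is what makes the delayed terms collapse to this single
    difference.

    All properties of the averages come from their differential equations
    y' = k y - f and y' = f - k y through one comparison principle
    ([future_comparison], [past_comparison]).  In particular the linearisation of
    T at 0 sends exp (x t) to (1 + chi x / ((n - x) (x + m))) exp (x t), where
    chi is the characteristic function of the equation at 0
    ([wave_map_symbol]).
    If chi lam = 0 and chi mu < 0 with lam < mu <= 2 lam, then
    min (1, exp (lam t)) is a supersolution and exp (lam t) - M exp (mu t) a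
    subsolution.  Such lam and mu exist for small delays, since without delays
    chi x = x^2 - c x + p - delta has two distinct positive roots.

    T preserves the class of nondecreasing functions with a fixed Lipschitz
    constant lying between these two barriers.  The class is closed under
    pointwise infima, so the Knaster-Tarski argument gives a fixed point without
    any continuity of T or passage to the limit under an integral
    ([monotone_fixed_point]).  A fixed point is twice differentiable and solves
    the equation ([fixed_point_ode]); the barriers give its limit at minus
    infinity, and a limit l < 1 at plus infinity would force phi' to minus
    infinity because g l > delta l ([fixed_point_limit]). *)

(** * Calculus on the real line *)

Lemma mean_value (F dF : R -> R) (x y : R) :
  (forall t, is_derive F t (dF t)) -> x <= y ->
  exists z, x <= z <= y /\ F y - F x = dF z * (y - x).
Proof.
  intros H Hxy.
  destruct (MVT_gen F x y dF) as [z Hz].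
  - intros t _; apply H.
  - intros t _; apply derivable_continuous_pt, ex_derive_Reals_0.
    exists (dF t); apply H.
  - rewrite (Rmin_left x y Hxy), (Rmax_right x y Hxy) in Hz; now exists z.
Qed.

Lemma nondecreasing_of_derive (F dF : R -> R) :
  (forall t, is_derive F t (dF t)) -> (forall t, 0 <= dF t) ->
  forall x y, x <= y -> F x <= F y.
Proof.
  intros H H0 x y Hxy.
  destruct (mean_value F dF x y H Hxy) as [z [_ Hz]].
  specialize (H0 z); nra.
Qed.

Lemma nonincreasing_of_derive (F dF : R -> R) :
  (forall t, is_derive F t (dF t)) -> (forall t, dF t <= 0) ->
  forall x y, x <= y -> F y <= F x.
Proof.
  intros H H0 x y Hxy.
  destruct (mean_value F dF x y H Hxy) as [z [_ Hz]].
  specialize (H0 z); nra.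
Qed.

Lemma is_derive_shift (F : R -> R) (s t l : R) :
  is_derive F (t + s) l -> is_derive (fun x => F (x + s)) t l.
Proof.
  intros H.
  replace l with (scal 1 l) by (unfold scal; simpl; unfold mult; simpl; ring).
  apply (is_derive_comp F (fun x => x + s)); [exact H|].
  auto_derive; [exact I|ring].
Qed.

Lemma continuous_of_lipschitz (L : R) (phi : R -> R) :
  (forall x y, x <= y -> 0 <= phi y - phi x <= L * (y - x)) ->
  forall x, continuous phi x.
Proof.
  intros H x.
  assert (HL : 0 <= L) by (specialize (H 0 1); lra).
  apply filterlim_locally; intros eps.
  assert (Hd : 0 < eps / (L + 1)).
  { apply Rdiv_lt_0_compat; [apply cond_pos|lra]. }
  exists (mkposreal _ Hd); intros y Hy.
  change (Rabs (y - x) < eps / (L + 1)) in Hy.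
  change (Rabs (phi y - phi x) < eps).
  apply (Rmult_lt_compat_l (L + 1)) in Hy; [|lra].
  replace ((L + 1) * (eps / (L + 1))) with (pos eps) in Hy by (field; lra).
  apply Rle_lt_trans with (2 := Hy).
  destruct (Rle_or_lt x y) as [Hxy|Hxy].
  - specialize (H x y Hxy); rewrite !Rabs_pos_eq; lra.
  - specialize (H y x (Rlt_le _ _ Hxy)); rewrite !Rabs_left1; lra.
Qed.

Lemma is_lim_of_exp_bound (L : R) (phi : R -> R) :
  0 < L -> (forall t, 0 <= phi t <= exp (L * t)) -> is_lim phi m_infty 0.
Proof.
  intros HL H.
  apply (is_lim_le_le_loc (fun _ => 0) (fun t => exp (L * t))).
  - exists 0; intros t _; apply H.
  - apply is_lim_const.
  - apply (is_lim_comp exp (fun t => L * t) m_infty 0 m_infty).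
    + apply is_lim_exp_m.
    + evar_last; [apply is_lim_scal_l, is_lim_id|].
      unfold Rbar_mult, Rbar_mult'; destruct Rle_dec as [H1|H1]; [|lra].
      destruct (Rle_lt_or_eq_dec 0 L H1); [reflexivity|lra].
    + exists 0; intros; discriminate.
Qed.

Lemma is_lim_of_nondecreasing (phi : R -> R) (B : R) :
  (forall x y, x <= y -> phi x <= phi y) -> (forall x, phi x <= B) ->
  exists l : R, is_lim phi p_infty l /\ forall x, phi x <= l.
Proof.
  intros Hinc HB.
  destruct (completeness (fun y => exists x, y = phi x)) as [l [Hup Hleast]].
  - exists B; intros y [x ->]; apply HB.
  - now exists (phi 0), 0.
  - exists l; split; [|intros x; apply Hup; now exists x].
    apply is_lim_spec; intros eps.
    destruct (Classical_Prop.classic (exists x, l - eps < phi x)) as [[x Hx]|Hn].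
    + exists x; intros y Hy.
      assert (phi y <= l) by (apply Hup; now exists y).
      generalize (Hinc x y (Rlt_le _ _ Hy)); intros.
      apply Rabs_def1; lra.
    + exfalso.
      assert (l <= l - eps); [|generalize (cond_pos eps); lra].
      apply Hleast; intros y [x ->].
      apply Rnot_lt_le; intros Hx; apply Hn; now exists x.
Qed.

Lemma is_lim_shift (phi : R -> R) (s l : R) :
  is_lim phi p_infty l -> is_lim (fun t => phi (t + s)) p_infty l.
Proof.
  intros H; apply is_lim_spec; apply is_lim_spec in H.
  intros eps; destruct (H eps) as [A HA].
  exists (A - s); intros t Ht; apply HA; lra.
Qed.

(** * Comparison for first-order equations *)

(** The equation says that exp (- k t) D t has derivative - exp (- k t) f t. *)
Lemma discounted_nonincreasing (k : R) (D f : R -> R) :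
  (forall t, is_derive D t (k * D t - f t)) -> (forall t, 0 <= f t) ->
  forall x y, x <= y -> D y <= exp (k * (y - x)) * D x.
Proof.
  intros HD Hf x y Hxy.
  assert (H : exp (- k * y) * D y <= exp (- k * x) * D x).
  { apply (nonincreasing_of_derive (fun t => exp (- k * t) * D t)
             (fun t => - (exp (- k * t) * f t))); [| |exact Hxy].
    - intros t; auto_derive; [now exists (k * D t - f t)|].
      rewrite (is_derive_unique (fun x : R => D x) _ _ (HD t)); ring.
    - intros t; generalize (exp_pos (- k * t)) (Hf t); intros; nra. }
  apply (Rmult_le_compat_l (exp (k * y))) in H; [|left; apply exp_pos].
  rewrite <- !Rmult_assoc, <- !exp_plus in H.
  replace (k * y + - k * y) with 0 in H by ring.
  replace (k * y + - k * x) with (k * (y - x)) in H by ring.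
  rewrite exp_0 in H; lra.
Qed.

(** A solution that is negative somewhere stays below a negative multiple of
    exp (k t) from there on, which growth of order exp (kap t) with kap < k
    excludes.  A bound from below at plus infinity is the natural hypothesis: it
    covers bounded functions and their differences with exponentials. *)
Lemma future_comparison (k kap C : R) (D f : R -> R) :
  kap < k ->
  (forall t, is_derive D t (k * D t - f t)) -> (forall t, 0 <= f t) ->
  (forall t, 0 <= t -> - C * exp (kap * t) <= D t) ->
  forall t, 0 <= D t.
Proof.
  intros Hk HD Hf Hg t0.
  destruct (Rle_or_lt 0 (D t0)) as [H|H]; [exact H|exfalso].
  assert (Hlim : forall t, 0 <= t -> t0 <= t -> 
            exp ((k - kap) * t) * (- D t0 * exp (- (k * t0))) <= C).
  { intros t Ht Htt.
    generalize (discounted_nonincreasing k D f HD Hf t0 t Htt); intros H1.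
    specialize (Hg t Ht).
    assert (H2 : exp (k * (t - t0)) * - D t0 <= C * exp (kap * t)) by lra.
    apply (Rmult_le_compat_l (exp (- (kap * t)))) in H2; [|left; apply exp_pos].
    replace (exp (- (kap * t)) * (C * exp (kap * t))) with
      (C * exp (- (kap * t) + kap * t)) in H2 by (rewrite exp_plus; ring).
    replace (- (kap * t) + kap * t) with 0 in H2 by ring.
    rewrite exp_0 in H2.
    replace (exp ((k - kap) * t) * (- D t0 * exp (- (k * t0)))) with
      (exp (- (kap * t)) * (exp (k * (t - t0)) * - D t0)); [lra|].
    replace ((k - kap) * t) with (- (kap * t) + k * (t - t0) + k * t0) by ring.
    rewrite !exp_plus.
    transitivity (exp (- (kap * t)) * exp (k * (t - t0)) * - D t0 *
                    exp (k * t0 + - (k * t0))); [|rewrite exp_plus; ring].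
    replace (k * t0 + - (k * t0)) with 0 by ring. rewrite exp_0; ring. }
  set (a := - D t0 * exp (- (k * t0))) in *.
  assert (Ha : 0 < a) by (unfold a; generalize (exp_pos (- (k * t0))); nra).
  (* by 1 + z <= e^z, this time already violates the bound *)
  pose (t := Rmax (Rmax 0 t0) (C / a / (k - kap))).
  assert (H0 : 0 <= t) by (unfold t; generalize (Rmax_l (Rmax 0 t0) (C / a / (k - kap))) (Rmax_l 0 t0); lra).
  assert (H1 : t0 <= t) by (unfold t; generalize (Rmax_l (Rmax 0 t0) (C / a / (k - kap))) (Rmax_r 0 t0); lra).
  assert (H2 : C / a / (k - kap) <= t) by apply Rmax_r.
  specialize (Hlim t H0 H1).
  generalize (exp_ineq1_le ((k - kap) * t)); intros H3.
  apply (Rmult_le_compat_l (k - kap)) in H2; [|lra].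
  replace ((k - kap) * (C / a / (k - kap))) with (C / a) in H2 by (field; lra).
  assert (H4 : C = C / a * a) by (field; lra).
  nra.
Qed.

(** The mirror image: reversing time exchanges the two equations. *)
Lemma past_comparison (k C : R) (D f : R -> R) :
  0 < k ->
  (forall t, is_derive D t (f t - k * D t)) -> (forall t, 0 <= f t) ->
  (forall t, t <= 0 -> - C <= D t) ->
  forall t, 0 <= D t.
Proof.
  intros Hk HD Hf Hg t.
  replace t with (- - t) by ring.
  apply (future_comparison k 0 C (fun s => D (- s)) (fun s => f (- s))).
  - exact Hk.
  - intros s; auto_derive; [now exists (f (- s) - k * D (- s))|].
    rewrite (is_derive_unique (fun x : R => D x) _ _ (HD (- s))); ring.
  - intros s; apply Hf.
  - intros s Hs; rewrite Rmult_0_l, exp_0.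
    specialize (Hg (- s)); lra.
Qed.

(** * One-sided exponential averages *)

(** This is the integral of exp (- k u) f (t + u) over u >= 0, for f continuous
    and bounded.  It is written through a primitive and the limit of that
    primitive, so that its differential equation is immediate. *)
Definition future (k : R) (f : R -> R) (t : R) : R :=
  let F x := RInt (fun s => exp (- k * s) * f s) 0 x in
  exp (k * t) * (real (Lim_seq (fun j => F (INR j))) - F t).

(** The integral of exp (- k u) f (t - u) over u >= 0. *)
Definition past (k : R) (f : R -> R) (t : R) : R :=
  future k (fun s => f (- s)) (- t).

Lemma is_derive_discounted_primitive (k : R) (f : R -> R) :
  (forall x, continuous f x) ->
  forall t, is_derive (fun x => RInt (fun s => exp (- k * s) * f s) 0 x) t
              (exp (- k * t) * f t).
Proof.
  intros Hf t.
  assert (Hc : forall x, continuous (fun s => exp (- k * s) * f s) x).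
  { intros x.
    apply (continuous_mult (fun s => exp (- k * s)) f); [|apply Hf].
    apply (ex_derive_continuous (fun s => exp (- k * s))); auto_derive; exact I. }
  apply (is_derive_RInt (fun s => exp (- k * s) * f s) _ 0); [|apply Hc].
  exists (mkposreal 1 Rlt_0_1); intros x _.
  apply (RInt_correct (fun s => exp (- k * s) * f s)), ex_RInt_continuous.
  intros z _; apply Hc.
Qed.

Lemma is_derive_future (k : R) (f : R -> R) :
  (forall x, continuous f x) ->
  forall t, is_derive (future k f) t (k * future k f t - f t).
Proof.
  intros Hf t.
  generalize (is_derive_discounted_primitive k f Hf); intros HF.
  unfold future.
  set (F := fun x => RInt (fun s => exp (- k * s) * f s) 0 x) in *.
  change (is_derive (fun x => exp (k * x) * (Lim_seq (fun j => F (INR j)) - F x)) t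
            (k * (exp (k * t) * (Lim_seq (fun j => F (INR j)) - F t)) - f t)).
  auto_derive; [now exists (exp (- k * t) * f t)|].
  rewrite (is_derive_unique (fun x : R => F x) _ _ (HF t)).
  transitivity (k * (exp (k * t) * (Lim_seq (fun j => F (INR j)) - F t))
     - exp (k * t + - k * t) * f t); [rewrite exp_plus; ring|].
  replace (k * t + - k * t) with 0 by ring. rewrite exp_0; ring.
Qed.

(** With F the primitive of exp (- k s) f s, both F and
    - F - (M / k) exp (- k .) are nondecreasing; this squeezes the tail
    lim F - F t between 0 and (M / k) exp (- k t). *)
Lemma future_bounds (k M : R) (f : R -> R) :
  0 < k -> (forall x, continuous f x) -> (forall x, 0 <= f x <= M) ->
  forall t, 0 <= future k f t <= M / k.
Proof.
  intros Hk Hc Hf t.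
  generalize (is_derive_discounted_primitive k f Hc); intros HF.
  unfold future.
  set (F := fun x => RInt (fun s => exp (- k * s) * f s) 0 x) in *.
  change (0 <= exp (k * t) * (Lim_seq (fun j => F (INR j)) - F t) <= M / k).
  assert (Hinc : forall x y, x <= y -> F x <= F y).
  { apply (nondecreasing_of_derive F _ HF).
    intros s; generalize (exp_pos (- k * s)) (Hf s); nra. }
  assert (Hdec : forall x y, x <= y ->
     F y + M / k * exp (- k * y) <= F x + M / k * exp (- k * x)).
  { apply (nonincreasing_of_derive (fun y => F y + M / k * exp (- k * y))
             (fun y => exp (- k * y) * (f y - M))).
    - intros s; auto_derive; [now exists (exp (- k * s) * f s)|].
      rewrite (is_derive_unique (fun x : R => F x) _ _ (HF s)).
      field; lra.
    - intros s; generalize (exp_pos (- k * s)) (Hf s); nra. }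
  assert (HM : 0 <= M / k).
  { apply Rdiv_le_0_compat; [|exact Hk]; generalize (Hf 0); lra. }
  assert (Hup : forall x y, F y <= F x + M / k * exp (- k * x)).
  { intros x y; destruct (Rle_or_lt x y) as [H|H].
    - generalize (Hdec x y H) (exp_pos (- k * y)); nra.
    - generalize (Hinc y x (Rlt_le _ _ H)) (exp_pos (- k * x)); nra. }
  destruct (ex_finite_lim_seq_incr (fun j => F (INR j)) (F 0 + M / k * exp (- k * 0)))
    as [l Hl].
  { intros j; apply Hinc; rewrite S_INR; lra. }
  { intros j; apply Hup. }
  rewrite (is_lim_seq_unique _ _ Hl); simpl.
  assert (H1 : F t <= l).
  { destruct (nfloor_ex (Rmax 0 t) (Rmax_l 0 t)) as [j0 Hj0].
    apply (is_lim_seq_le_loc (fun _ => F t) (fun j => F (INR j)) (F t) l);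
      [|apply is_lim_seq_const|exact Hl].
    exists (S j0); intros j Hj; apply Hinc.
    apply le_INR in Hj; rewrite S_INR in Hj.
    generalize (Rmax_r 0 t); lra. }
  assert (H2 : l <= F t + M / k * exp (- k * t)).
  { apply (is_lim_seq_le (fun j => F (INR j)) (fun _ => F t + M / k * exp (- k * t))
      l (F t + M / k * exp (- k * t)));
      [intros j; apply Hup|exact Hl|apply is_lim_seq_const]. }
  generalize (exp_pos (k * t)); intros He.
  assert (H3 : exp (k * t) * exp (- k * t) = 1).
  { rewrite <- exp_plus; replace (k * t + - k * t) with 0 by ring; apply exp_0. }
  split; [nra|].
  apply Rle_trans with (exp (k * t) * (M / k * exp (- k * t))).
  - apply Rmult_le_compat_l; lra.
  - right; transitivity (M / k * (exp (k * t) * exp (- k * t))); [ring|].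
    rewrite H3; ring.
Qed.

Lemma continuous_reflect (f : R -> R) :
  (forall x, continuous f x) -> forall x, continuous (fun s => f (- s)) x.
Proof.
  intros Hf x; apply (continuous_comp Ropp f); [|apply Hf].
  apply (ex_derive_continuous Ropp); auto_derive; exact I.
Qed.

Lemma continuous_shift (f : R -> R) (s : R) :
  (forall x, continuous f x) -> forall x, continuous (fun t => f (t + s)) x.
Proof.
  intros Hf x; apply (continuous_comp (fun t => t + s) f); [|apply Hf].
  apply (ex_derive_continuous (fun t => t + s)); auto_derive; exact I.
Qed.

Lemma is_derive_past (k : R) (f : R -> R) :
  (forall x, continuous f x) ->
  forall t, is_derive (past k f) t (f t - k * past k f t).
Proof.
  intros Hf t.
  pose (G := future k (fun s => f (- s))).
  assert (H : is_derive G (- t) (k * G (- t) - f (- - t))) by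
    apply (is_derive_future k _ (continuous_reflect f Hf)).
  rewrite Ropp_involutive in H.
  change (is_derive (fun t => G (- t)) t (f t - k * G (- t))).
  auto_derive; [eexists; exact H|].
  rewrite (is_derive_unique (fun x : R => G x) _ _ H); ring.
Qed.

Lemma past_bounds (k M : R) (f : R -> R) :
  0 < k -> (forall x, continuous f x) -> (forall x, 0 <= f x <= M) ->
  forall t, 0 <= past k f t <= M / k.
Proof.
  intros Hk Hc Hf t; unfold past.
  apply future_bounds; [exact Hk|now apply continuous_reflect|intros; apply Hf].
Qed.

Lemma exp_le_compat (x y : R) : x <= y -> exp x <= exp y.
Proof.
  intros [H|H]; [left; now apply exp_increasing|right; now rewrite H].
Qed.

Lemma is_derive_exp_lin (lam A t : R) :
  is_derive (fun x => A * exp (lam * x)) t (lam * (A * exp (lam * t))).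
Proof. auto_derive; [exact I|ring]. Qed.

(** On exponentials the averages act as multiplication by 1 / (k - lam) and
    1 / (lam + k); the comparison principle transfers exponential barriers for f
    to the averages although the barriers themselves are unbounded. *)
Lemma future_le_exp (k B A lam : R) (f : R -> R) :
  0 < k -> lam < k -> 0 <= A ->
  (forall x, continuous f x) -> (forall x, 0 <= f x <= B) ->
  (forall x, f x <= A * exp (lam * x)) ->
  forall t, future k f t <= A / (k - lam) * exp (lam * t).
Proof.
  intros Hk Hl HA Hc Hb Hf t.
  enough (0 <= A / (k - lam) * exp (lam * t) - future k f t) by lra.
  revert t.
  apply (future_comparison k 0 (B / k) _ (fun t => A * exp (lam * t) - f t) Hk).
  - intros t; evar_last.
    + apply (is_derive_minus (fun t => A / (k - lam) * exp (lam * t)) (future k f)).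
      * apply is_derive_exp_lin.
      * now apply is_derive_future.
    + unfold minus, plus, opp; simpl; field; lra.
  - intros t; specialize (Hf t); lra.
  - intros t _; rewrite Rmult_0_l, exp_0.
    generalize (future_bounds k B f Hk Hc Hb t) (exp_pos (lam * t)); intros H1 H2.
    assert (0 <= A / (k - lam)) by (apply Rdiv_le_0_compat; lra).
    nra.
Qed.

Lemma past_le_exp (k B A lam : R) (f : R -> R) :
  0 < k -> 0 < lam -> 0 <= A ->
  (forall x, continuous f x) -> (forall x, 0 <= f x <= B) ->
  (forall x, f x <= A * exp (lam * x)) ->
  forall t, past k f t <= A / (lam + k) * exp (lam * t).
Proof.
  intros Hk Hl HA Hc Hb Hf t.
  enough (0 <= A / (lam + k) * exp (lam * t) - past k f t) by lra.
  revert t.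
  apply (past_comparison k (B / k) _ (fun t => A * exp (lam * t) - f t) Hk).
  - intros t; evar_last.
    + apply (is_derive_minus (fun t => A / (lam + k) * exp (lam * t)) (past k f)).
      * apply is_derive_exp_lin.
      * now apply is_derive_past.
    + unfold minus, plus, opp; simpl; field; lra.
  - intros t; specialize (Hf t); lra.
  - intros t _.
    generalize (past_bounds k B f Hk Hc Hb t) (exp_pos (lam * t)); intros H1 H2.
    assert (0 <= A / (lam + k)) by (apply Rdiv_le_0_compat; lra).
    nra.
Qed.

Lemma future_ge_exp (k B A C lam mu : R) (f : R -> R) :
  0 < k -> lam < k -> mu < k -> 0 <= A -> 0 <= C ->
  (forall x, continuous f x) -> (forall x, 0 <= f x <= B) ->
  (forall x, A * exp (lam * x) - C * exp (mu * x) <= f x) ->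
  forall t, A / (k - lam) * exp (lam * t) - C / (k - mu) * exp (mu * t)
            <= future k f t.
Proof.
  intros Hk Hl Hm HA HC Hc Hb Hf t.
  enough (0 <= future k f t - (A / (k - lam) * exp (lam * t)
                              - C / (k - mu) * exp (mu * t))) by lra.
  revert t.
  apply (future_comparison k lam (A / (k - lam)) _
           (fun t => f t - (A * exp (lam * t) - C * exp (mu * t))) Hl).
  - intros t; evar_last.
    + apply (is_derive_minus (future k f)); [now apply is_derive_future|].
      apply (is_derive_minus (fun t => A / (k - lam) * exp (lam * t))
               (fun t => C / (k - mu) * exp (mu * t))); apply is_derive_exp_lin.
    + unfold minus, plus, opp; simpl; field; lra.
  - intros t; specialize (Hf t); lra.
  - intros t _.
    generalize (future_bounds k B f Hk Hc Hb t) (exp_pos (mu * t)); intros H1 H2.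
    assert (0 <= C / (k - mu)) by (apply Rdiv_le_0_compat; lra).
    nra.
Qed.

Lemma past_ge_exp (k B A C lam mu : R) (f : R -> R) :
  0 < k -> 0 < lam -> 0 < mu -> 0 <= A -> 0 <= C ->
  (forall x, continuous f x) -> (forall x, 0 <= f x <= B) ->
  (forall x, A * exp (lam * x) - C * exp (mu * x) <= f x) ->
  forall t, A / (lam + k) * exp (lam * t) - C / (mu + k) * exp (mu * t)
            <= past k f t.
Proof.
  intros Hk Hl Hm HA HC Hc Hb Hf t.
  enough (0 <= past k f t - (A / (lam + k) * exp (lam * t)
                              - C / (mu + k) * exp (mu * t))) by lra.
  revert t.
  apply (past_comparison k (A / (lam + k)) _
           (fun t => f t - (A * exp (lam * t) - C * exp (mu * t))) Hk).
  - intros t; evar_last.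
    + apply (is_derive_minus (past k f)); [now apply is_derive_past|].
      apply (is_derive_minus (fun t => A / (lam + k) * exp (lam * t))
               (fun t => C / (mu + k) * exp (mu * t))); apply is_derive_exp_lin.
    + unfold minus, plus, opp; simpl; field; lra.
  - intros t; specialize (Hf t); lra.
  - intros t Ht.
    generalize (past_bounds k B f Hk Hc Hb t) (exp_pos (mu * t)); intros H1 H2.
    assert (0 <= C / (mu + k)) by (apply Rdiv_le_0_compat; lra).
    assert (0 <= A / (lam + k)) by (apply Rdiv_le_0_compat; lra).
    assert (exp (lam * t) <= 1) by (rewrite <- exp_0; apply exp_le_compat; nra).
    nra.
Qed.

Lemma future_le (k B B' : R) (f h : R -> R) :
  0 < k -> (forall x, continuous f x) -> (forall x, 0 <= f x <= B) ->
  (forall x, continuous h x) -> (forall x, 0 <= h x <= B') ->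
  (forall x, f x <= h x) -> forall t, future k f t <= future k h t.
Proof.
  intros Hk Hcf Hbf Hch Hbh Hfh t.
  enough (0 <= future k h t - future k f t) by lra.
  revert t.
  apply (future_comparison k 0 (B / k) _ (fun t => h t - f t) Hk).
  - intros t; evar_last.
    + exact (is_derive_minus _ _ t _ _ (is_derive_future k h Hch t)
               (is_derive_future k f Hcf t)).
    + unfold minus, plus, opp; simpl; ring.
  - intros t; specialize (Hfh t); lra.
  - intros t _; rewrite Rmult_0_l, exp_0.
    generalize (future_bounds k B f Hk Hcf Hbf t)
      (future_bounds k B' h Hk Hch Hbh t); lra.
Qed.

Lemma past_le (k B B' : R) (f h : R -> R) :
  0 < k -> (forall x, continuous f x) -> (forall x, 0 <= f x <= B) ->
  (forall x, continuous h x) -> (forall x, 0 <= h x <= B') ->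
  (forall x, f x <= h x) -> forall t, past k f t <= past k h t.
Proof.
  intros Hk Hcf Hbf Hch Hbh Hfh t; unfold past.
  apply (future_le k B B'); auto using continuous_reflect.
Qed.

Lemma future_nondecreasing (k B : R) (f : R -> R) :
  0 < k -> (forall x, continuous f x) -> (forall x, 0 <= f x <= B) ->
  (forall x y, x <= y -> f x <= f y) ->
  forall x y, x <= y -> future k f x <= future k f y.
Proof.
  intros Hk Hc Hb Hf x y Hxy.
  replace y with (x + (y - x)) by ring.
  assert (Hw : 0 <= y - x) by lra.
  generalize (y - x) Hw; clear y Hxy Hw; intros w Hw.
  enough (0 <= future k f (x + w) - future k f x) by lra.
  revert x; apply (future_comparison k 0 (B / k) _
    (fun t => f (t + w) - f t) Hk).
  - intros t; evar_last.
    + exact (is_derive_minus _ _ t _ _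
               (is_derive_shift (future k f) w _ _ (is_derive_future k f Hc (t + w)))
               (is_derive_future k f Hc t)).
    + unfold minus, plus, opp; simpl; ring.
  - intros t; generalize (Hf t (t + w)); lra.
  - intros t _; rewrite Rmult_0_l, exp_0.
    generalize (future_bounds k B f Hk Hc Hb t)
      (future_bounds k B f Hk Hc Hb (t + w)); lra.
Qed.

Lemma past_nondecreasing (k B : R) (f : R -> R) :
  0 < k -> (forall x, continuous f x) -> (forall x, 0 <= f x <= B) ->
  (forall x y, x <= y -> f x <= f y) ->
  forall x y, x <= y -> past k f x <= past k f y.
Proof.
  intros Hk Hc Hb Hf x y Hxy.
  replace y with (x + (y - x)) by ring.
  assert (Hw : 0 <= y - x) by lra.
  generalize (y - x) Hw; clear y Hxy Hw; intros w Hw.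
  enough (0 <= past k f (x + w) - past k f x) by lra.
  revert x; apply (past_comparison k (B / k) _
    (fun t => f (t + w) - f t) Hk).
  - intros t; evar_last.
    + exact (is_derive_minus _ _ t _ _
               (is_derive_shift (past k f) _ _ _ (is_derive_past k f Hc (t + w)))
               (is_derive_past k f Hc t)).
    + unfold minus, plus, opp; simpl; ring.
  - intros t; generalize (Hf t (t + w)); lra.
  - intros t _.
    generalize (past_bounds k B f Hk Hc Hb t)
      (past_bounds k B f Hk Hc Hb (t + w)); lra.
Qed.

(** * Fixed points of order-preserving maps *)

(** Knaster-Tarski: the infimum of all supersolutions in X is a fixed point.
    Closure of X under pointwise infima replaces any continuity of T. *)
Lemma monotone_fixed_point (X : (R -> R) -> Prop) (T : (R -> R) -> R -> R) (u : R -> R) :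
  (forall phi, X phi -> forall t, 0 <= phi t) ->
  (forall phi, X phi -> X (T phi)) ->
  (forall phi psi, X phi -> X psi -> (forall t, phi t <= psi t) ->
     forall t, T phi t <= T psi t) ->
  (forall (Y : (R -> R) -> Prop) (phi : R -> R), (exists psi, Y psi) ->
     (forall psi, Y psi -> X psi) ->
     (forall t, is_glb_Rbar (fun y => exists psi, Y psi /\ y = psi t) (phi t)) ->
     X phi) ->
  X u -> (forall t, T u t <= u t) ->
  exists phi, X phi /\ forall t, T phi t = phi t.
Proof.
  intros X_ge0 X_T T_le X_inf Xu Tu.
  pose (Y := fun psi => X psi /\ forall t, T psi t <= psi t).
  pose (E := fun t y => exists psi, Y psi /\ y = psi t).
  pose (phi := fun t => real (Glb_Rbar (E t))).
  assert (Yu : Y u) by now split.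
  assert (Hglb : forall t, is_glb_Rbar (E t) (phi t)).
  { intros t; assert (H := Glb_Rbar_correct (E t)); unfold phi.
    destruct (Glb_Rbar (E t)) as [l| |]; simpl; [exact H| |].
    - destruct H as [H _]; destruct (H (u t)); now exists u.
    - destruct H as [_ H]; destruct (H 0).
      intros y [psi [[Hpsi _] ->]]; apply X_ge0, Hpsi. }
  assert (HX : X phi).
  { apply (X_inf Y); [now exists u|now intros psi []|exact Hglb]. }
  assert (Hlow : forall psi, Y psi -> forall t, phi t <= psi t).
  { intros psi Hpsi t; apply (proj1 (Hglb t)); now exists psi. }
  assert (Hge : forall t, T phi t <= phi t).
  { intros t; apply (proj2 (Hglb t) (T phi t)).
    intros y [psi [Hpsi ->]]; simpl.
    apply Rle_trans with (T psi t); [|apply Hpsi].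
    apply T_le; [exact HX|apply Hpsi|now apply Hlow]. }
  exists phi; split; [exact HX|intros t].
  apply Rle_antisym; [apply Hge|].
  apply Hlow; split; [now apply X_T|].
  apply T_le; [now apply X_T|exact HX|exact Hge].
Qed.

(** * The integral operator of the wave equation *)

(** Discharges the differentiability conditions that [auto_derive] leaves for
    functions known only through a differential equation. *)
Ltac from_is_derive :=
  match goal with
  | H : forall t, is_derive ?F t _ |- ex_derive (fun x => ?F x) ?y =>
      exact (ex_intro _ _ (H y))
  end.

(** Its fixed points are the profiles.  For phi differentiable with bounded
    derivative, T phi = phi amounts to
    (d/dt - n) (d/dt + m) phi = c ((phi' + m phi) (. + r) - (phi' + m phi))
    - m^2 phi - g (phi (. + s)): (d/dt + m) turns the first summand into
    [future n] of m^2 phi + g (phi (. + s)), and (d/dt - n) (future n f) = - f. *)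
Definition wave_map (c m r s : R) (g phi : R -> R) (t : R) : R :=
  let n := c + m in
  let h := fun x => g (phi (x + s)) in
  (m ^ 2 * (past m phi t + future n phi t) + (past m h t + future n h t)) / (m + n)
  + c * (future n phi t - future n phi (t + r)).

(** The derivative of [wave_map], in which the values of f cancel between the
    equations of [past m f] and [future n f]. *)
Definition wave_map_derivative (c m r s : R) (g phi : R -> R) (t : R) : R :=
  let n := c + m in
  let h := fun x => g (phi (x + s)) in
  (m ^ 2 * (n * future n phi t - m * past m phi t)
     + (n * future n h t - m * past m h t)) / (m + n)
  + c * (n * future n phi t - phi t - (n * future n phi (t + r) - phi (t + r))).

(** The key positivity: for the linear part of [wave_map], the difference
    D t - D (t + r) is at least (1 - exp (n r)) D t, and for small r the term
    m^2 D t / (m + n) outweighs it.  The arguments P1, P2, F2 stand for the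
    remaining averages, and D for [future n] of a nonnegative function; it may
    also be a difference between an exponential and such an average, which is
    how the barriers are treated. *)
Lemma wave_kernel_nonneg (c m r P1 P2 F2 t : R) (D f : R -> R) :
  0 < c -> 0 < m -> 0 <= r ->
  c * (m + (c + m)) * (exp ((c + m) * r) - 1) <= m ^ 2 ->
  (forall t, is_derive D t ((c + m) * D t - f t)) -> (forall t, 0 <= f t) ->
  (forall t, 0 <= D t) -> 0 <= P1 -> 0 <= P2 -> 0 <= F2 ->
  0 <= (m ^ 2 * (P1 + D t) + (P2 + F2)) / (m + (c + m)) + c * (D t - D (t + r)).
Proof.
  intros Hc Hm Hr Hsmall HD Hf HD0 HP1 HP2 HF2.
  assert (H := discounted_nonincreasing (c + m) D f HD Hf t (t + r)).
  replace (t + r - t) with r in H by ring.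
  assert (H1 : D (t + r) <= exp ((c + m) * r) * D t) by (apply H; lra).
  specialize (HD0 t).
  assert (H2 : c * (exp ((c + m) * r) - 1) <= m ^ 2 / (m + (c + m))).
  { apply Rmult_le_reg_r with (m + (c + m)); [lra|].
    replace (m ^ 2 / (m + (c + m)) * (m + (c + m))) with (m ^ 2) by (field; lra).
    lra. }
  assert (H3 : m ^ 2 / (m + (c + m)) * D t <=
     (m ^ 2 * (P1 + D t) + (P2 + F2)) / (m + (c + m))).
  { unfold Rdiv; rewrite Rmult_assoc, (Rmult_comm _ (D t)), <- Rmult_assoc.
    apply Rmult_le_compat_r; [left; apply Rinv_0_lt_compat; lra|].
    generalize (pow2_ge_0 m); intros; nra. }
  apply (Rmult_le_compat_r (D t)) in H2; [|exact HD0].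
  apply (Rmult_le_compat_l c) in H1; lra.
Qed.

Section Wave.

Context (c m r s : R) (g : R -> R).
Context (c_pos : 0 < c) (m_pos : 0 < m) (r_ge0 : 0 <= r).
Context (r_small : c * (m + (c + m)) * (exp ((c + m) * r) - 1) <= m ^ 2).
Context (g_cont : forall x, continuous g x).
Context (g_ge0 : forall x, 0 <= x <= 1 -> 0 <= g x).
Context (g_incr : forall x y, 0 <= x -> x <= y -> y <= 1 -> g x <= g y).
Context (g_1 : g 1 = c * m).

Let n := c + m.
Let T := wave_map c m r s g.

Let n_pos : 0 < n.
Proof. unfold n; lra. Qed.

Section Profile.

Context (phi : R -> R).
Context (phi_cont : forall x, continuous phi x).
Context (phi_01 : forall x, 0 <= phi x <= 1).

Let h := fun x => g (phi (x + s)).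

Lemma birth_cont : forall x, continuous h x.
Proof.
  intros x; apply (continuous_comp (fun y => phi (y + s)) g); [|apply g_cont].
  now apply continuous_shift.
Qed.

Lemma birth_bounds : forall x, 0 <= h x <= c * m.
Proof.
  intros x; unfold h; split; [now apply g_ge0|].
  rewrite <- g_1; apply g_incr; [| |lra]; apply phi_01.
Qed.

(** The upper bound is T 1 = 1, which holds because
    m^2 + g 1 = m^2 + c m = m n; it is obtained from the positivity lemma
    applied to 1 - phi. *)
Lemma wave_map_01 : forall t, 0 <= T phi t <= 1.
Proof.
  intros t.
  assert (HF := future_bounds n 1 phi n_pos phi_cont phi_01).
  assert (HP := past_bounds m 1 phi m_pos phi_cont phi_01).
  assert (HF' := future_bounds n (c * m) h n_pos birth_cont birth_bounds).
  assert (HP' := past_bounds m (c * m) h m_pos birth_cont birth_bounds).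
  assert (HD := is_derive_future n phi phi_cont).
  split.
  - apply (wave_kernel_nonneg c m r _ _ _ t (future n phi) phi);
      try assumption; [apply phi_01|apply HF|apply HP|apply HP'|apply HF'].
  - enough (0 <= 1 - T phi t) by lra.
    replace (1 - T phi t) with
      ((m ^ 2 * ((1 / m - past m phi t) + (1 / n - future n phi t))
        + ((c * m / m - past m h t) + (c * m / n - future n h t))) / (m + n)
       + c * ((1 / n - future n phi t) - (1 / n - future n phi (t + r)))).
    2:{ unfold T, wave_map; fold n; fold h; unfold n; field; lra. }
    apply (wave_kernel_nonneg c m r _ _ _ t
             (fun t => 1 / n - future n phi t) (fun t => 1 - phi t));
      try assumption.
    + intros x; evar_last.
      * exact (is_derive_minus (fun _ => 1 / n) (future n phi) x _ _
                 (is_derive_const _ _) (HD x)).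
      * unfold minus, plus, opp, zero; simpl; fold n; field; lra.
    + intros x; specialize (phi_01 x); lra.
    + intros x; specialize (HF x); lra.
    + specialize (HP t); lra.
    + specialize (HP' t); lra.
    + specialize (HF' t); lra.
Qed.

Lemma is_derive_wave_map :
  forall t, is_derive (T phi) t (wave_map_derivative c m r s g phi t).
Proof.
  intros t.
  assert (H1 := is_derive_future n phi phi_cont).
  assert (H2 := is_derive_past m phi phi_cont).
  assert (H3 := is_derive_future n h birth_cont).
  assert (H4 := is_derive_past m h birth_cont).
  unfold T, wave_map, wave_map_derivative; fold n; fold h.
  set (A := future n phi) in *; set (B := past m phi) in *.
  set (E := future n h) in *; set (G := past m h) in *.
  clearbody A B E G.
  auto_derive.
  - repeat split; from_is_derive.
  - rewrite (is_derive_unique (fun x : R => A x) _ _ (H1 t)),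
      (is_derive_unique (fun x : R => A x) _ _ (H1 (t + r))),
      (is_derive_unique (fun x : R => B x) _ _ (H2 t)),
      (is_derive_unique (fun x : R => E x) _ _ (H3 t)),
      (is_derive_unique (fun x : R => G x) _ _ (H4 t)).
    unfold n; field; lra.
Qed.

Lemma wave_map_derivative_le :
  forall t, wave_map_derivative c m r s g phi t <= n + 2 * c.
Proof.
  intros t.
  assert (HF := future_bounds n 1 phi n_pos phi_cont phi_01).
  assert (HP := past_bounds m 1 phi m_pos phi_cont phi_01 t).
  assert (HF' := future_bounds n (c * m) h n_pos birth_cont birth_bounds).
  assert (HP' := past_bounds m (c * m) h m_pos birth_cont birth_bounds t).
  assert (Hscale : forall B x, 0 <= x <= B / n -> 0 <= n * x <= B).
  { intros B x Hx; split; [apply Rmult_le_pos; lra|].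
    replace B with (n * (B / n)) by (field; lra).
    apply Rmult_le_compat_l; lra. }
  unfold wave_map_derivative; fold n; fold h.
  assert (H1 := Hscale _ _ (HF t)).
  assert (H2 := Hscale _ _ (HF (t + r))).
  assert (H3 := Hscale _ _ (HF' t)).
  assert (H4 := phi_01 t). assert (H5 := phi_01 (t + r)).
  set (a := n * future n phi t) in *.
  set (b := n * future n phi (t + r)) in *.
  set (d := n * future n h t) in *.
  assert (Hu : 0 <= m * past m phi t) by (apply Rmult_le_pos; lra).
  assert (Hv : 0 <= m * past m h t) by (apply Rmult_le_pos; lra).
  set (u := m * past m phi t) in *.
  set (v := m * past m h t) in *.
  assert (Hnum : (m ^ 2 * (a - u) + (d - v)) / (m + n) <= n).
  { apply Rmult_le_reg_r with (m + n); [lra|].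
    replace ((m ^ 2 * (a - u) + (d - v)) / (m + n) * (m + n)) with
      (m ^ 2 * (a - u) + (d - v)) by (field; lra).
    assert (m ^ 2 * (a - u) <= m ^ 2 * 1).
    { apply Rmult_le_compat_l; [apply pow2_ge_0|lra]. }
    unfold n; nra. }
  assert (c * (a - phi t - (b - phi (t + r))) <= c * 2)
    by (apply Rmult_le_compat_l; lra).
  lra.
Qed.

(** T commutes with translations, so this is positivity applied to
    phi (. + w) - phi. *)
Lemma wave_map_nondecreasing :
  (forall x y, x <= y -> phi x <= phi y) ->
  forall x y, x <= y -> T phi x <= T phi y.
Proof.
  intros Hphi x y Hxy.
  assert (Hh : forall x y, x <= y -> h x <= h y).
  { intros u v Huv; apply g_incr; [apply phi_01| |apply phi_01].
    apply Hphi; lra. }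
  assert (HF := future_nondecreasing n 1 phi n_pos phi_cont phi_01 Hphi).
  assert (HP := past_nondecreasing m 1 phi m_pos phi_cont phi_01 Hphi x y Hxy).
  assert (HF' := future_nondecreasing n (c * m) h n_pos birth_cont birth_bounds Hh x y Hxy).
  assert (HP' := past_nondecreasing m (c * m) h m_pos birth_cont birth_bounds Hh x y Hxy).
  set (w := y - x).
  assert (Hw : 0 <= w) by (unfold w; lra).
  enough (0 <= T phi y - T phi x) by lra.
  replace (T phi y - T phi x) with
    ((m ^ 2 * ((past m phi y - past m phi x) + (future n phi (x + w) - future n phi x))
      + ((past m h y - past m h x) + (future n h y - future n h x))) / (m + n)
     + c * ((future n phi (x + w) - future n phi x)
            - (future n phi (x + r + w) - future n phi (x + r)))).
  2:{ replace (x + w) with y by (unfold w; ring).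
      replace (x + r + w) with (y + r) by (unfold w; ring).
      unfold T, wave_map; fold n; fold h; unfold n; field; lra. }
  clearbody w.
  apply (wave_kernel_nonneg c m r _ _ _ x
           (fun t => future n phi (t + w) - future n phi t)
           (fun t => phi (t + w) - phi t)); try assumption; try lra.
  - intros t; evar_last.
    + exact (is_derive_minus _ _ t _ _
               (is_derive_shift (future n phi) w _ _ (is_derive_future n phi phi_cont (t + w)))
               (is_derive_future n phi phi_cont t)).
    + unfold minus, plus, opp; simpl; fold n; ring.
  - intros t; generalize (Hphi t (t + w)); lra.
  - intros t; generalize (HF t (t + w)); lra.
Qed.

End Profile.

Lemma wave_map_le (phi psi : R -> R) :
  (forall x, continuous phi x) -> (forall x, 0 <= phi x <= 1) ->
  (forall x, continuous psi x) -> (forall x, 0 <= psi x <= 1) ->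
  (forall x, phi x <= psi x) -> forall t, T phi t <= T psi t.
Proof.
  intros Hc Hb Hc' Hb' Hle t.
  assert (Hh : forall x, g (phi (x + s)) <= g (psi (x + s))).
  { intros x; apply g_incr; [apply Hb|apply Hle|apply Hb']. }
  assert (HF := future_le n 1 1 phi psi n_pos Hc Hb Hc' Hb' Hle).
  assert (HP := past_le m 1 1 phi psi m_pos Hc Hb Hc' Hb' Hle t).
  assert (HF' := future_le n _ _ _ _ n_pos (birth_cont phi Hc) (birth_bounds phi Hb)
    (birth_cont psi Hc') (birth_bounds psi Hb') Hh t).
  assert (HP' := past_le m _ _ _ _ m_pos (birth_cont phi Hc) (birth_bounds phi Hb)
    (birth_cont psi Hc') (birth_bounds psi Hb') Hh t).
  enough (0 <= T psi t - T phi t) by lra.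
  replace (T psi t - T phi t) with
    ((m ^ 2 * ((past m psi t - past m phi t) + (future n psi t - future n phi t))
      + ((past m (fun z => g (psi (z + s))) t - past m (fun z => g (phi (z + s))) t)
         + (future n (fun z => g (psi (z + s))) t
            - future n (fun z => g (phi (z + s))) t))) / (m + n)
     + c * ((future n psi t - future n phi t)
            - (future n psi (t + r) - future n phi (t + r)))).
  2:{ unfold T, wave_map; fold n; unfold n; field; lra. }
  apply (wave_kernel_nonneg c m r _ _ _ t
           (fun t => future n psi t - future n phi t)
           (fun t => psi t - phi t)); try assumption; try lra.
  - intros x; evar_last.
    + exact (is_derive_minus _ _ x _ _ (is_derive_future n psi Hc' x)
               (is_derive_future n phi Hc x)).
    + unfold minus, plus, opp; simpl; fold n; ring.
  - intros x; generalize (Hle x); lra.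
  - intros x; generalize (HF x); lra.
Qed.

(** The formula for phi' = (T phi)' involves phi and averages of phi only, so it
    can be differentiated once more; eliminating the averages between phi, phi'
    and phi'' leaves the delay equation. *)
Lemma fixed_point_ode (phi : R -> R) :
  (forall x, continuous phi x) ->
  (forall t, T phi t = phi t) ->
  let dphi := wave_map_derivative c m r s g phi in
  forall t, is_derive phi t (dphi t) /\
    is_derive dphi t (c * dphi (t + r) + c * m * phi (t + r) - g (phi (t + s))).
Proof.
  intros Hc Hfix dphi.
  assert (Hd : forall t, is_derive phi t (dphi t)).
  { intros t; apply (is_derive_ext (T phi)); [exact Hfix|].
    now apply is_derive_wave_map. }
  intros t; split; [apply Hd|].
  assert (H1 := is_derive_future n phi Hc).
  assert (H2 := is_derive_past m phi Hc).
  assert (H3 := is_derive_future n _ (birth_cont phi Hc)).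
  assert (H4 := is_derive_past m _ (birth_cont phi Hc)).
  assert (Hphi := Hfix t).
  assert (Hdphi : forall t, dphi t = wave_map_derivative c m r s g phi t) by reflexivity.
  unfold T, wave_map in Hphi; fold n in Hphi.
  unfold wave_map_derivative in Hdphi; fold n in Hdphi.
  clearbody dphi.
  set (h := fun x => g (phi (x + s))) in *.
  change (g (phi (t + s))) with (h t).
  set (A := future n phi) in *; set (B := past m phi) in *.
  set (E := future n h) in *; set (G := past m h) in *.
  clearbody h A B E G.
  apply (is_derive_ext _ _ _ _ (fun x => eq_sym (Hdphi x))).
  auto_derive.
  - repeat split; from_is_derive.
  - rewrite (is_derive_unique (fun x : R => A x) _ _ (H1 t)),
      (is_derive_unique (fun x : R => A x) _ _ (H1 (t + r))),
      (is_derive_unique (fun x : R => B x) _ _ (H2 t)),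
      (is_derive_unique (fun x : R => E x) _ _ (H3 t)),
      (is_derive_unique (fun x : R => G x) _ _ (H4 t)),
      (is_derive_unique (fun x : R => phi x) _ _ (Hd t)),
      (is_derive_unique (fun x : R => phi x) _ _ (Hd (t + r))), (Hdphi t), <- Hphi.
    unfold n; field; lra.
Qed.

(** * Exponential barriers *)

Context (p K lam mu M : R).
Context (p_ge0 : 0 <= p) (K_ge0 : 0 <= K).
Context (g_le : forall x, 0 <= x <= 1 -> g x <= p * x).
Context (g_ge : forall x, 0 <= x <= 1 -> p * x - K * x ^ 2 <= g x).
Context (g_gt : forall x, 0 < x < 1 -> c * m * x < g x).

(** The linearisation of the wave equation at 0 has the solution exp (x t)
    exactly when this vanishes. *)
Definition characteristic (x : R) : R :=
  x ^ 2 - (c * x + c * m) * exp (x * r) + p * exp (x * s).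

Context (lam_pos : 0 < lam) (lam_mu : lam < mu) (mu_2lam : mu <= 2 * lam).
Context (mu_n : mu < n).
Context (chi_lam : characteristic lam = 0).
Context (M_ge1 : 1 <= M) (M_large : K * exp (mu * s) <= M * - characteristic mu).

(** The factor by which the linearised operator multiplies exp (x t): at
    A = p exp (x s) it exceeds 1 exactly where the characteristic function is
    positive. *)
Lemma wave_map_symbol (x A : R) : 0 < x -> x < n ->
  (m ^ 2 * (1 / (x + m) + 1 / (n - x)) + (A / (x + m) + A / (n - x))) / (m + n)
  + c * (1 / (n - x) - exp (x * r) / (n - x))
  = 1 + (x ^ 2 - (c * x + c * m) * exp (x * r) + A) / ((n - x) * (x + m)).
Proof.
  intros H0 Hn; unfold n in *; field; repeat split; lra.
Qed.

Lemma wave_map_le_exp (phi : R -> R) :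
  (forall x, continuous phi x) -> (forall x, 0 <= phi x <= 1) ->
  (forall x, phi x <= exp (lam * x)) -> forall t, T phi t <= exp (lam * t).
Proof.
  intros Hc Hb Hle t.
  set (h := fun x => g (phi (x + s))).
  set (A := p * exp (lam * s)).
  assert (Hlam : lam < n) by lra.
  assert (HA : 0 <= A) by (apply Rmult_le_pos; [lra|left; apply exp_pos]).
  assert (Hhc : forall x, continuous h x) by now apply birth_cont.
  assert (Hhb : forall x, 0 <= h x <= c * m) by now apply birth_bounds.
  assert (Hle1 : forall x, phi x <= 1 * exp (lam * x))
    by (intros x; rewrite Rmult_1_l; apply Hle).
  assert (Hh : forall x, h x <= A * exp (lam * x)).
  { intros x; apply Rle_trans with (p * phi (x + s)); [apply g_le, Hb|].
    unfold A; rewrite Rmult_assoc, <- exp_plus.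
    apply Rmult_le_compat_l; [exact p_ge0|].
    replace (lam * s + lam * x) with (lam * (x + s)) by ring; apply Hle. }
  assert (HF := future_le_exp n 1 1 lam phi n_pos Hlam Rle_0_1 Hc Hb Hle1).
  assert (HP := past_le_exp m 1 1 lam phi m_pos lam_pos Rle_0_1 Hc Hb Hle1 t).
  assert (HF' := future_le_exp n _ A lam h n_pos Hlam HA Hhc Hhb Hh t).
  assert (HP' := past_le_exp m _ A lam h m_pos lam_pos HA Hhc Hhb Hh t).
  enough (0 <= exp (lam * t) - T phi t) by lra.
  set (D := fun t => 1 / (n - lam) * exp (lam * t) - future n phi t).
  replace (exp (lam * t) - T phi t) with
    ((m ^ 2 * ((1 / (lam + m) * exp (lam * t) - past m phi t) + D t)
      + ((A / (lam + m) * exp (lam * t) - past m h t)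
         + (A / (n - lam) * exp (lam * t) - future n h t))) / (m + n)
     + c * (D t - D (t + r))).
  2:{ assert (Hs := wave_map_symbol lam A lam_pos Hlam).
      replace (lam ^ 2 - (c * lam + c * m) * exp (lam * r) + A) with 0 in Hs
        by (symmetry; exact chi_lam).
      unfold D; rewrite (Rmult_plus_distr_l lam), exp_plus.
      transitivity (((m ^ 2 * (1 / (lam + m) + 1 / (n - lam))
          + (A / (lam + m) + A / (n - lam))) / (m + n)
        + c * (1 / (n - lam) - exp (lam * r) / (n - lam))) * exp (lam * t) - T phi t).
      - unfold T, wave_map; fold n; fold h; field; lra.
      - rewrite Hs; field; lra. }
  apply (wave_kernel_nonneg c m r _ _ _ t D (fun t => 1 * exp (lam * t) - phi t));
    try assumption; try lra.
  - intros x; evar_last.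
    + exact (is_derive_minus _ _ x _ _ (is_derive_exp_lin lam (1 / (n - lam)) x)
               (is_derive_future n phi Hc x)).
    + unfold minus, plus, opp, D; simpl; fold n; field; lra.
  - intros x; generalize (Hle1 x); lra.
  - intros x; unfold D; generalize (HF x); lra.
Qed.

(** The quadratic error of the linearisation is absorbed by the second
    exponential: phi^2 <= exp (mu t), because phi <= min (1, exp (lam t)) and
    lam < mu <= 2 lam.  It costs K exp (mu s) against the gain
    - M chi mu, whence the size of M. *)
Lemma wave_map_ge_exp (phi : R -> R) :
  (forall x, continuous phi x) -> (forall x, 0 <= phi x <= 1) ->
  (forall x, phi x <= exp (lam * x)) ->
  (forall x, exp (lam * x) - M * exp (mu * x) <= phi x) ->
  forall t, exp (lam * t) - M * exp (mu * t) <= T phi t.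
Proof.
  intros Hc Hb Hle Hge t.
  set (h := fun x => g (phi (x + s))).
  set (A := p * exp (lam * s)).
  set (C := (p * M + K) * exp (mu * s)).
  assert (Hlam : lam < n) by lra.
  assert (mu_pos : 0 < mu) by lra.
  assert (HA : 0 <= A) by (apply Rmult_le_pos; [lra|left; apply exp_pos]).
  assert (HC : 0 <= C).
  { apply Rmult_le_pos; [|left; apply exp_pos].
    assert (0 <= p * M) by (apply Rmult_le_pos; lra); lra. }
  assert (M_ge0 : 0 <= M) by lra.
  assert (Hhc : forall x, continuous h x) by now apply birth_cont.
  assert (Hhb : forall x, 0 <= h x <= c * m) by now apply birth_bounds.
  assert (Hge1 : forall x, 1 * exp (lam * x) - M * exp (mu * x) <= phi x)
    by (intros x; rewrite Rmult_1_l; apply Hge).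
  assert (Hsq : forall x, phi x ^ 2 <= exp (mu * x)).
  { intros x; destruct (Rle_or_lt x 0) as [Hx|Hx].
    - apply Rle_trans with (exp (lam * x) ^ 2).
      + apply pow_incr; split; [apply Hb|apply Hle].
      + simpl; rewrite Rmult_1_r, <- exp_plus.
        apply exp_le_compat; nra.
    - apply Rle_trans with 1; [generalize (Hb x); nra|].
      rewrite <- exp_0; apply exp_le_compat; nra. }
  assert (Hh : forall x, A * exp (lam * x) - C * exp (mu * x) <= h x).
  { intros x; apply Rle_trans with (2 := g_ge _ (Hb (x + s))).
    unfold A, C; rewrite !Rmult_assoc, <- !exp_plus.
    replace (lam * s + lam * x) with (lam * (x + s)) by ring.
    replace (mu * s + mu * x) with (mu * (x + s)) by ring.
    generalize (Rmult_le_compat_l p _ _ p_ge0 (Hge (x + s)))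
      (Rmult_le_compat_l K _ _ K_ge0 (Hsq (x + s))); lra. }
  assert (HF := future_ge_exp n 1 1 M lam mu phi n_pos Hlam mu_n Rle_0_1 M_ge0 Hc Hb Hge1).
  assert (HP := past_ge_exp m 1 1 M lam mu phi m_pos lam_pos mu_pos Rle_0_1 M_ge0 Hc Hb Hge1 t).
  assert (HF' := future_ge_exp n _ A C lam mu h n_pos Hlam mu_n HA HC Hhc Hhb Hh t).
  assert (HP' := past_ge_exp m _ A C lam mu h m_pos lam_pos mu_pos HA HC Hhc Hhb Hh t).
  set (D := fun t => future n phi t - (1 / (n - lam) * exp (lam * t)
                                       - M / (n - mu) * exp (mu * t))).
  assert (Hpos : 0 <=
    (m ^ 2 * ((past m phi t - (1 / (lam + m) * exp (lam * t) - M / (mu + m) * exp (mu * t)))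
              + D t)
      + ((past m h t - (A / (lam + m) * exp (lam * t) - C / (mu + m) * exp (mu * t)))
         + (future n h t - (A / (n - lam) * exp (lam * t) - C / (n - mu) * exp (mu * t)))))
      / (m + n)
     + c * (D t - D (t + r))).
  { apply (wave_kernel_nonneg c m r _ _ _ t D
      (fun t => phi t - (1 * exp (lam * t) - M * exp (mu * t))));
      try assumption; try lra.
    - intros x; evar_last.
      + exact (is_derive_minus _ _ x _ _ (is_derive_future n phi Hc x)
          (is_derive_minus _ _ x _ _ (is_derive_exp_lin lam (1 / (n - lam)) x)
             (is_derive_exp_lin mu (M / (n - mu)) x))).
      + unfold minus, plus, opp, D; simpl; fold n; field; lra.
    - intros x; generalize (Hge1 x); lra.
    - intros x; unfold D; generalize (HF x); lra. }
  assert (Hs := wave_map_symbol lam A lam_pos Hlam).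
  replace (lam ^ 2 - (c * lam + c * m) * exp (lam * r) + A) with 0 in Hs
    by (symmetry; exact chi_lam).
  assert (Hs' := wave_map_symbol mu (p * exp (mu * s)) mu_pos mu_n).
  change (mu ^ 2 - (c * mu + c * m) * exp (mu * r) + p * exp (mu * s))
    with (characteristic mu) in Hs'.
  set (q := (n - mu) * (mu + m)) in *.
  assert (Hq : 0 < q) by (apply Rmult_lt_0_compat; lra).
  assert (Heq : T phi t - (exp (lam * t) - M * exp (mu * t)) =
    ((m ^ 2 * ((past m phi t - (1 / (lam + m) * exp (lam * t) - M / (mu + m) * exp (mu * t)))
              + D t)
      + ((past m h t - (A / (lam + m) * exp (lam * t) - C / (mu + m) * exp (mu * t)))
         + (future n h t - (A / (n - lam) * exp (lam * t) - C / (n - mu) * exp (mu * t)))))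
      / (m + n)
     + c * (D t - D (t + r)))
    + (M * - characteristic mu - K * exp (mu * s)) / q * exp (mu * t)).
  { transitivity (T phi t
      - ((m ^ 2 * (1 / (lam + m) + 1 / (n - lam))
          + (A / (lam + m) + A / (n - lam))) / (m + n)
        + c * (1 / (n - lam) - exp (lam * r) / (n - lam))) * exp (lam * t)
      + (M * ((m ^ 2 * (1 / (mu + m) + 1 / (n - mu))
          + (p * exp (mu * s) / (mu + m) + p * exp (mu * s) / (n - mu))) / (m + n)
        + c * (1 / (n - mu) - exp (mu * r) / (n - mu)))
        + M * - characteristic mu / q) * exp (mu * t)).
    - rewrite Hs, Hs'; field; lra.
    - unfold D, C; rewrite !(Rmult_plus_distr_l _ t r), !exp_plus.
      unfold q, T, wave_map; fold n; fold h; unfold n; field; unfold n in *; repeat split; lra. }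
  assert (0 <= (M * - characteristic mu - K * exp (mu * s)) / q * exp (mu * t)).
  { apply Rmult_le_pos; [apply Rdiv_le_0_compat; lra|left; apply exp_pos]. }
  lra.
Qed.

(** * Existence of a monotone profile *)

Definition admissible (phi : R -> R) : Prop :=
  (forall t, 0 <= phi t <= 1) /\
  (forall t, exp (lam * t) - M * exp (mu * t) <= phi t <= exp (lam * t)) /\
  (forall x y, x <= y -> 0 <= phi y - phi x <= (n + 2 * c) * (y - x)).

Lemma wave_map_admissible (phi : R -> R) : admissible phi -> admissible (T phi).
Proof.
  intros [Hb [He HL]].
  assert (Hc := continuous_of_lipschitz _ phi HL).
  split; [|split].
  - now apply wave_map_01.
  - intros t; split.
    + apply wave_map_ge_exp; auto; intros x; apply He.
    + apply wave_map_le_exp; auto; intros x; apply He.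
  - intros x y Hxy; split.
    + enough (T phi x <= T phi y) by lra.
      apply wave_map_nondecreasing; auto.
      intros u v Huv; specialize (HL u v Huv); lra.
    + destruct (mean_value (T phi) _ x y (is_derive_wave_map phi Hc) Hxy) as [z [_ Hz]].
      rewrite Hz; apply Rmult_le_compat_r; [lra|].
      now apply wave_map_derivative_le.
Qed.

Lemma admissible_inf (Y : (R -> R) -> Prop) (phi : R -> R) :
  (exists psi, Y psi) -> (forall psi, Y psi -> admissible psi) ->
  (forall t, is_glb_Rbar (fun y => exists psi, Y psi /\ y = psi t) (phi t)) ->
  admissible phi.
Proof.
  intros [u Yu] HY Hglb.
  assert (Hlow : forall psi, Y psi -> forall t, phi t <= psi t).
  { intros psi Hpsi t; apply (proj1 (Hglb t)); now exists psi. }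
  assert (Hge : forall t b, (forall psi, Y psi -> b <= psi t) -> b <= phi t).
  { intros t b Hb; apply (proj2 (Hglb t) b).
    intros y [psi [Hpsi ->]]; now apply Hb. }
  destruct (HY u Yu) as [Hb [He _]].
  split; [|split].
  - intros t; split; [|generalize (Hlow u Yu t) (Hb t); lra].
    apply Hge; intros psi Hpsi; apply (HY psi Hpsi).
  - intros t; split; [|generalize (Hlow u Yu t) (He t); lra].
    apply Hge; intros psi Hpsi; apply (HY psi Hpsi).
  - intros x y Hxy; split.
    + enough (phi x <= phi y) by lra.
      apply Hge; intros psi Hpsi; destruct (HY psi Hpsi) as [_ [_ HL]].
      generalize (HL x y Hxy) (Hlow psi Hpsi x); lra.
    + enough (phi y - (n + 2 * c) * (y - x) <= phi x) by lra.
      apply Hge; intros psi Hpsi; destruct (HY psi Hpsi) as [_ [_ HL]].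
      generalize (HL x y Hxy) (Hlow psi Hpsi y); lra.
Qed.

Let upper (t : R) : R := Rmin 1 (exp (lam * t)).

(** This needs the barriers to be ordered, which holds at t <= 0 trivially and
    at t > 0 because M >= 1 and lam < mu make the subsolution negative. *)
Lemma upper_admissible : admissible upper.
Proof.
  split; [|split]; unfold upper.
  - intros t; split; [|apply Rmin_l].
    apply Rmin_glb; [lra|left; apply exp_pos].
  - intros t; split; [|apply Rmin_r].
    assert (0 < exp (mu * t)) by apply exp_pos.
    apply Rmin_glb; [|nra].
    destruct (Rle_or_lt t 0) as [Ht|Ht].
    + assert (exp (lam * t) <= 1) by (rewrite <- exp_0; apply exp_le_compat; nra).
      nra.
    + assert (exp (lam * t) <= exp (mu * t)) by (apply exp_le_compat; nra).
      nra.
  - intros x y Hxy.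
    set (w := lam * (y - x)).
    assert (Hw : 0 <= w) by (unfold w; nra).
    assert (Hle : w <= (n + 2 * c) * (y - x))
      by (unfold w; apply Rmult_le_compat_r; lra).
    assert (Hx : exp (lam * x) = exp (lam * y) * exp (- w)).
    { rewrite <- exp_plus; f_equal; unfold w; ring. }
    assert (H1 := exp_ineq1_le (- w)).
    assert (H2 := exp_pos (lam * y)).
    assert (H3 : exp (- w) <= 1) by (rewrite <- exp_0; apply exp_le_compat; lra).
    rewrite Hx; unfold Rmin.
    assert (H0 := exp_pos (- w)).
    set (e := exp (- w)) in *; set (E := exp (lam * y)) in *; clearbody e E w.
    assert (H4 : E * e <= E * 1) by (apply Rmult_le_compat_l; lra).
    destruct (Rle_dec 1 E) as [Hy|Hy]; destruct (Rle_dec 1 (E * e)) as [Hz|Hz];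
      try apply Rnot_le_lt in Hy; try apply Rnot_le_lt in Hz; split; try lra.
    + assert (1 * e <= E * e) by (apply Rmult_le_compat_r; lra); lra.
    + assert (E * (1 - e) <= 1 * (1 - e)) by (apply Rmult_le_compat_r; lra); lra.
Qed.

Lemma upper_supersolution : forall t, T upper t <= upper t.
Proof.
  destruct upper_admissible as [Hb [He HL]].
  assert (Hc := continuous_of_lipschitz _ upper HL).
  intros t; apply Rmin_glb.
  - now apply wave_map_01.
  - apply wave_map_le_exp; auto; intros x; apply He.
Qed.

Lemma admissible_fixed_point :
  exists phi, admissible phi /\ forall t, T phi t = phi t.
Proof.
  apply (monotone_fixed_point admissible T upper).
  - intros phi [Hb _] t; apply Hb.
  - apply wave_map_admissible.
  - intros phi psi [Hb [_ HL]] [Hb' [_ HL']] Hle.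
    apply wave_map_le; auto; now apply (continuous_of_lipschitz (n + 2 * c)).
  - apply admissible_inf.
  - apply upper_admissible.
  - apply upper_supersolution.
Qed.

(** Being monotone, phi has a limit l, and l > 0 by the lower barrier.  If l < 1,
    then phi' - c phi (. + r) has derivative tending to c m l - g l < 0, hence
    tends to minus infinity, and so does phi': phi could not stay monotone. *)
Lemma fixed_point_limit (phi : R -> R) :
  admissible phi -> (forall t, T phi t = phi t) -> is_lim phi p_infty 1.
Proof.
  intros [Hb [He HL]] Hfix.
  assert (Hc := continuous_of_lipschitz _ phi HL).
  destruct (is_lim_of_nondecreasing phi 1) as [l [Hlim Hup]].
  { intros x y Hxy; specialize (HL x y Hxy); lra. }
  { intros x; apply Hb. }
  assert (Hl0 : 0 < l).
  { (* where M exp ((mu - lam) t) = exp (-1), the lower bound is positive *)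
    set (t := - (1 + ln M) / (mu - lam)).
    apply Rlt_le_trans with (phi t); [|apply Hup].
    apply Rlt_le_trans with (2 := proj1 (He t)).
    replace (mu * t) with ((- (1 + ln M)) + lam * t) by (unfold t; field; lra).
    replace (- (1 + ln M)) with (-1 + - ln M) by ring.
    rewrite !exp_plus, exp_Ropp, exp_ln by lra.
    assert (exp (-1) < 1) by (rewrite <- exp_0; apply exp_increasing; lra).
    assert (0 < exp (lam * t)) by apply exp_pos.
    replace (M * (exp (-1) * / M * exp (lam * t))) with (exp (-1) * exp (lam * t))
      by (field; lra).
    nra. }
  assert (Hl1 : l <= 1).
  { apply (is_lim_le_loc phi (fun _ => 1) p_infty l 1); [|exact Hlim|apply is_lim_const].
    exists 0; intros t _; apply Hb. }
  destruct (Rle_lt_or_eq_dec l 1 Hl1) as [Hlt|Heq]; [exfalso|now rewrite Heq in Hlim].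
  assert (Hgl := g_gt l (conj Hl0 Hlt)).
  set (eta := (g l - c * m * l) / 2).
  assert (Heta : 0 < eta) by (unfold eta; lra).
  assert (Hgphi : is_lim (fun t => g (phi (t + s))) p_infty (g l)).
  { exact (filterlim_comp _ _ _ (fun t => phi (t + s)) g _ _ _
             (is_lim_shift phi s l Hlim) (g_cont l)). }
  apply is_lim_spec in Hgphi.
  destruct (Hgphi (mkposreal eta Heta)) as [t0 Ht0].
  set (dphi := wave_map_derivative c m r s g phi).
  assert (Hode := fixed_point_ode phi Hc Hfix).
  fold dphi in Hode.
  set (z := fun t => dphi t - c * phi (t + r)).
  assert (Hz : forall t, is_derive z t (c * m * phi (t + r) - g (phi (t + s)))).
  { intros t; evar_last.
    - exact (is_derive_minus _ _ t _ _ (proj2 (Hode t))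
        (is_derive_scal _ t c _ (is_derive_shift phi r t _ (proj1 (Hode (t + r)))))).
    - unfold minus, plus, opp; simpl; ring. }
  set (t1 := t0 + 1).
  assert (Hdec : forall t, t1 <= t -> z t <= z t1 - eta * (t - t1)).
  { intros t Ht; destruct (mean_value z _ t1 t Hz Ht) as [x [Hx Hzx]].
    enough (z t - z t1 <= - eta * (t - t1)) by lra.
    rewrite Hzx; apply Rmult_le_compat_r; [lra|].
    assert (Hx0 : t0 < x) by (unfold t1 in Hx; lra).
    specialize (Ht0 x Hx0); simpl in Ht0; apply Rabs_def2 in Ht0.
    assert (c * m * phi (x + r) <= c * m * l).
    { apply Rmult_le_compat_l; [|apply Hup]; left; apply Rmult_lt_0_compat; lra. }
    unfold eta in *; lra. }
  set (t2 := t1 + (Rabs (z t1) + c + 1) / eta).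
  assert (Ht12 : t1 <= t2).
  { unfold t2; enough (0 <= (Rabs (z t1) + c + 1) / eta) by lra.
    apply Rdiv_le_0_compat; [|exact Heta]; generalize (Rabs_pos (z t1)); lra. }
  destruct (mean_value phi dphi t2 (t2 + 1) (fun t => proj1 (Hode t))) as [x [Hx Hphi]];
    [lra|].
  assert (Hneg : dphi x <= -1).
  { assert (H1 : z x <= z t1 - eta * (x - t1)) by (apply Hdec; lra).
    assert (H2 : eta * (t2 - t1) <= eta * (x - t1)) by (apply Rmult_le_compat_l; lra).
    replace (eta * (t2 - t1)) with (Rabs (z t1) + c + 1) in H2
      by (unfold t2; field; lra).
    assert (H3 := Rle_abs (z t1)).
    assert (H4 : c * phi (x + r) <= c * 1) by (apply Rmult_le_compat_l; [lra|apply Hb]).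
    unfold z in H1 at 1; lra. }
  assert (H5 := HL t2 (t2 + 1)); lra.
Qed.

Lemma monostable_wave :
  exists phi dphi : R -> R,
    (forall t, is_derive phi t (dphi t)) /\
    (forall t, is_derive dphi t
       (c * dphi (t + r) + c * m * phi (t + r) - g (phi (t + s)))) /\
    (forall t, 0 <= phi t <= 1) /\
    is_lim phi m_infty 0 /\ is_lim phi p_infty 1.
Proof.
  destruct admissible_fixed_point as [phi [Hadm Hfix]].
  destruct (Hadm) as [Hb [He HL]].
  assert (Hc := continuous_of_lipschitz _ phi HL).
  exists phi, (wave_map_derivative c m r s g phi).
  split; [|split; [|split; [|split]]].
  - intros t; now apply fixed_point_ode.
  - intros t; now apply fixed_point_ode.
  - exact Hb.
  - apply (is_lim_of_exp_bound lam phi lam_pos).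
    intros t; split; [apply Hb|apply He].
  - now apply fixed_point_limit.
Qed.

End Wave.

(** * Roots of the characteristic function *)

(** The quadratic x^2 - c x + b has two distinct positive roots; nu and mu lie
    on either side of the smaller one, so close that mu <= 2 nu. *)
Lemma undelayed_characteristic_signs (c b : R) :
  0 < c -> 0 < b -> 4 * b < c ^ 2 ->
  exists nu mu, 0 < nu /\ nu < mu /\ mu <= 2 * nu /\ mu < c /\
    0 < nu ^ 2 - c * nu + b /\ mu ^ 2 - c * mu + b < 0.
Proof.
  intros Hc Hb Hdisc.
  set (d := sqrt (c ^ 2 - 4 * b)).
  assert (Hd0 : 0 < d) by (apply sqrt_lt_R0; lra).
  assert (Hd2 : d ^ 2 = c ^ 2 - 4 * b) by (apply pow2_sqrt; lra).
  assert (Hdc : d < c) by nra.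
  set (lam := (c - d) / 2).
  assert (Hlam : 0 < lam) by (unfold lam; lra).
  assert (Hfact : forall x, x ^ 2 - c * x + b = (x - lam) * (x - lam - d)).
  { intros x; unfold lam.
    replace b with ((c ^ 2 - d ^ 2) / 4) by (rewrite Hd2; field); field. }
  set (eps := Rmin (lam / 3) (d / 2)).
  assert (Heps : 0 < eps) by (apply Rmin_glb_lt; lra).
  assert (H1 : eps <= lam / 3) by apply Rmin_l.
  assert (H2 : eps <= d / 2) by apply Rmin_r.
  assert (H3 : c = 2 * lam + d) by (unfold lam; lra).
  clearbody lam d eps.
  exists (lam - eps), (lam + eps).
  rewrite !Hfact; repeat split; nra.
Qed.

(** A perturbation of size eta of the exponentials keeps the signs of the
    characteristic function at nu and mu, so it still has a root between. *)
Lemma characteristic_root (c m p r s nu mu eta : R) :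
  0 < c -> 0 < m -> 0 < p -> 0 < nu -> nu < mu ->
  1 <= exp (mu * r) -> exp (nu * r) <= 1 + eta ->
  exp (mu * s) <= 1 + eta -> 1 - eta <= exp (nu * s) ->
  mu ^ 2 - (c * mu + c * m) + p * (1 + eta) < 0 ->
  0 < nu ^ 2 - (c * nu + c * m) * (1 + eta) + p * (1 - eta) ->
  characteristic c m r s p mu < 0 /\
  exists lam, nu < lam < mu /\ characteristic c m r s p lam = 0.
Proof.
  intros Hc Hm Hp Hnu Hlt E1 E2 E3 E4 Hmu0 Hnu0.
  assert (Hcm : 0 < c * m) by now apply Rmult_lt_0_compat.
  assert (Hneg : characteristic c m r s p mu < 0).
  { unfold characteristic.
    assert ((c * mu + c * m) * 1 <= (c * mu + c * m) * exp (mu * r))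
      by (apply Rmult_le_compat_l; [nra|exact E1]).
    assert (p * exp (mu * s) <= p * (1 + eta)) by (apply Rmult_le_compat_l; lra).
    lra. }
  assert (Hpos : 0 < characteristic c m r s p nu).
  { unfold characteristic.
    assert ((c * nu + c * m) * exp (nu * r) <= (c * nu + c * m) * (1 + eta))
      by (apply Rmult_le_compat_l; [nra|exact E2]).
    assert (p * (1 - eta) <= p * exp (nu * s)) by (apply Rmult_le_compat_l; lra).
    lra. }
  split; [exact Hneg|].
  destruct (IVT (fun x => - characteristic c m r s p x) nu mu) as [lam [Hlam H0]].
  - intros x; apply derivable_continuous_pt, ex_derive_Reals_0.
    unfold characteristic; auto_derive; exact I.
  - exact Hlt.
  - lra.
  - lra.
  - exists lam; split; [|lra].
    destruct Hlam as [Hl1 Hl2].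
    split; apply Rnot_le_lt; intros Hle.
    + assert (lam = nu) by lra; subst lam; lra.
    + assert (lam = mu) by lra; subst lam; lra.
Qed.

(** * The rescaled Ricker birth function *)

Section Ricker.

Context (delta p : R) (delta_pos : 0 < delta) (ratio : 1 < p / delta <= exp 1).

Let l := ln (p / delta).
Let g (x : R) : R := p * x * exp (- l * x).

Let p_gt : delta < p.
Proof.
  apply (Rmult_lt_reg_r (/ delta)); [now apply Rinv_0_lt_compat|].
  rewrite Rinv_r by lra; apply ratio.
Qed.

Let l_bounds : 0 < l <= 1.
Proof.
  unfold l; rewrite <- ln_1 at 1; rewrite <- (ln_exp 1) at 2.
  split; [apply ln_increasing; lra|].
  destruct (proj2 ratio) as [H|H]; [left; apply ln_increasing; lra|right; now rewrite H].
Qed.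

Lemma ricker_continuous x : continuous g x.
Proof. apply (ex_derive_continuous g); unfold g; auto_derive; exact I. Qed.

Lemma ricker_nonneg x : 0 <= x -> 0 <= g x.
Proof.
  intros Hx; unfold g; assert (H := exp_pos (- l * x)).
  apply Rmult_le_pos; [apply Rmult_le_pos|]; lra.
Qed.

(** By exp (- l (y - x)) >= 1 - l (y - x) >= 1 - (y - x); this is where
    p / delta <= e enters. *)
Lemma ricker_increasing x y : 0 <= x -> x <= y -> y <= 1 -> g x <= g y.
Proof.
  intros Hx Hxy Hy; unfold g.
  replace (- l * y) with (- l * x + - l * (y - x)) by ring.
  rewrite exp_plus, (Rmult_comm (exp _)), <- Rmult_assoc.
  apply Rmult_le_compat_r; [left; apply exp_pos|].
  rewrite Rmult_assoc; apply Rmult_le_compat_l; [lra|].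
  apply Rle_trans with (y * (1 + - l * (y - x))).
  - assert (l * (y - x) <= 1 * (y - x)) by (apply Rmult_le_compat_r; lra).
    assert (y * (l * (y - x)) <= 1 * (y - x)); [|lra].
    apply Rmult_le_compat; try lra; apply Rmult_le_pos; lra.
  - apply Rmult_le_compat_l; [lra|apply exp_ineq1_le].
Qed.

Let exp_l : p * exp (- l) = delta.
Proof.
  unfold l; rewrite exp_Ropp, exp_ln by lra; field; lra.
Qed.

Lemma ricker_at_1 : g 1 = delta.
Proof. unfold g; rewrite !Rmult_1_r; exact exp_l. Qed.

Lemma ricker_le_linear x : 0 <= x -> g x <= p * x.
Proof.
  intros Hx; unfold g; rewrite <- (Rmult_1_r (p * x)) at 2.
  apply Rmult_le_compat_l; [apply Rmult_le_pos; lra|].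
  rewrite <- exp_0; apply exp_le_compat; nra.
Qed.

Lemma ricker_ge_quadratic x : 0 <= x -> p * x - p * l * x ^ 2 <= g x.
Proof.
  intros Hx; unfold g.
  apply Rle_trans with (p * x * (1 + - l * x)); [right; ring|].
  apply Rmult_le_compat_l; [apply Rmult_le_pos; lra|apply exp_ineq1_le].
Qed.

Lemma ricker_above_linear x : 0 < x < 1 -> delta * x < g x.
Proof.
  intros Hx; unfold g; rewrite <- exp_l.
  replace (p * exp (- l) * x) with (p * x * exp (- l)) by ring.
  apply Rmult_lt_compat_l; [apply Rmult_lt_0_compat; lra|].
  apply exp_increasing; nra.
Qed.

End Ricker.

(** * Travelling waves for small delays *)

(** The smallness conditions are all linear in eta = exp (n rho) - 1: one for the
    positivity of the operator and two for the signs of the characteristic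
    function at nu and mu. *)
Lemma small_delay_profile (delta p c : R) :
  0 < delta -> 1 < p / delta <= exp 1 -> 2 * sqrt p < c ->
  exists rho, 0 < rho /\ forall r1 r2, 0 < r1 < rho -> 0 < r2 < rho ->
    exists phi dphi : R -> R,
      (forall t, is_derive phi t (dphi t)) /\
      (forall t, is_derive dphi t
        (c * dphi (t + r1) + delta * phi (t + r1)
          - p * phi (t + (r1 - r2)) * exp (- ln (p / delta) * phi (t + (r1 - r2))))) /\
      is_lim phi m_infty 0 /\ is_lim phi p_infty 1.
Proof.
  intros Hdelta Hratio Hcp.
  assert (Hp : delta < p).
  { apply (Rmult_lt_reg_r (/ delta)); [now apply Rinv_0_lt_compat|].
    rewrite Rinv_r by lra; apply Hratio. }
  assert (Hsp : 0 < sqrt p) by (apply sqrt_lt_R0; lra).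
  assert (Hsq : sqrt p ^ 2 = p) by (apply pow2_sqrt; lra).
  assert (Hc : 0 < c) by lra.
  assert (Hdisc : 0 < (c - 2 * sqrt p) * (c + 2 * sqrt p)) by (apply Rmult_lt_0_compat; lra).
  destruct (undelayed_characteristic_signs c (p - delta)) as
    [nu [mu [Hnu [Hlt [Hmu2 [Hmuc [Hpos Hneg]]]]]]]; [exact Hc|lra|nra|].
  set (m := delta / c).
  assert (Hm : 0 < m) by (apply Rdiv_lt_0_compat; lra).
  assert (Hcm : c * m = delta) by (unfold m; field; lra).
  set (n := c + m).
  set (chin := nu ^ 2 - c * nu + (p - delta)) in *.
  set (chim := mu ^ 2 - c * mu + (p - delta)) in *.
  set (q := c * nu + delta + p).
  assert (Hq : 0 < q) by (unfold q; nra).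
  assert (Hd : 0 < c * (m + n)) by (apply Rmult_lt_0_compat; unfold n; lra).
  set (eta := Rmin (m ^ 2 / (c * (m + n))) (Rmin (- chim / (2 * p)) (chin / (2 * q)))).
  assert (Heta : 0 < eta).
  { repeat apply Rmin_glb_lt; apply Rdiv_lt_0_compat; try lra.
    apply pow_lt; exact Hm. }
  assert (E1 : c * (m + n) * eta <= m ^ 2).
  { replace (m ^ 2) with (c * (m + n) * (m ^ 2 / (c * (m + n)))) by (field; unfold n; split; lra).
    apply Rmult_le_compat_l; [lra|apply Rmin_l]. }
  assert (E2 : p * eta < - chim).
  { apply Rle_lt_trans with (p * (- chim / (2 * p))).
    - apply Rmult_le_compat_l; [lra|].
      apply Rle_trans with (1 := Rmin_r _ _), Rmin_l.
    - replace (p * (- chim / (2 * p))) with (- chim / 2) by (field; lra); lra. }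
  assert (E3 : q * eta < chin).
  { apply Rle_lt_trans with (q * (chin / (2 * q))).
    - apply Rmult_le_compat_l; [lra|].
      apply Rle_trans with (1 := Rmin_r _ _), Rmin_r.
    - replace (q * (chin / (2 * q))) with (chin / 2) by (field; lra); lra. }
  clearbody eta.
  assert (Hn : 0 < n) by (unfold n; lra).
  set (rho := ln (1 + eta) / n).
  assert (Hrho : 0 < rho).
  { apply Rdiv_lt_0_compat; [|exact Hn].
    rewrite <- ln_1; apply ln_increasing; lra. }
  assert (Hexp : forall x y, 0 <= x <= n -> y <= rho -> exp (x * y) <= 1 + eta).
  { intros x y Hx Hy; rewrite <- (exp_ln (1 + eta)) by lra; apply exp_le_compat.
    replace (ln (1 + eta)) with (n * rho) by (unfold rho; field; lra).
    apply Rle_trans with (x * rho);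
      [apply Rmult_le_compat_l|apply Rmult_le_compat_r]; lra. }
  exists rho; split; [exact Hrho|intros r1 r2 Hr1 Hr2].
  set (s := r1 - r2).
  destruct (characteristic_root c m p r1 s nu mu eta) as [Hchim [lam [Hlam Hchi]]];
    try assumption; try lra.
  - rewrite <- exp_0; apply exp_le_compat; nra.
  - apply Hexp; unfold n; lra.
  - apply Hexp; unfold n, s; lra.
  - assert (H : exp (nu * - s) <= 1 + eta) by (apply Hexp; unfold n, s; lra).
    replace (nu * s) with (- (nu * - s)) by ring; rewrite exp_Ropp.
    apply Rle_trans with (/ (1 + eta)); [|apply Rinv_le_contravar; [apply exp_pos|exact H]].
    apply (Rmult_le_reg_r (1 + eta)); [lra|]; rewrite Rinv_l by lra; nra.
  - unfold chim in E2; lra.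
  - rewrite Hcm; unfold chin, q in E3; lra.
  - set (M := Rmax 1 (p * ln (p / delta) * exp (mu * s) / - characteristic c m r1 s p mu)).
    destruct (monostable_wave c m r1 s (fun x => p * x * exp (- ln (p / delta) * x)))
      with (p := p) (K := p * ln (p / delta)) (lam := lam) (mu := mu) (M := M)
      as [phi [dphi [H1 [H2 [_ [H3 H4]]]]]]; try assumption; try lra.
    + apply Rle_trans with (2 := E1); apply Rmult_le_compat_l; [lra|].
      enough (exp ((c + m) * r1) <= 1 + eta) by lra; apply Hexp; unfold n; lra.
    + apply ricker_continuous.
    + intros x Hx; now apply ricker_nonneg.
    + intros x y; now apply ricker_increasing.
    + rewrite Hcm; now apply ricker_at_1.
    + apply Rmult_le_pos; [lra|]; rewrite <- ln_1; left; apply ln_increasing; lra.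
    + intros x Hx; now apply ricker_le_linear.
    + intros x Hx; now apply ricker_ge_quadratic.
    + intros x Hx; rewrite Hcm; now apply ricker_above_linear.
    + apply Rmax_l.
    + apply Rle_trans with
        (p * ln (p / delta) * exp (mu * s) / - characteristic c m r1 s p mu
           * - characteristic c m r1 s p mu); [right; field; lra|].
      apply Rmult_le_compat_r; [lra|apply Rmax_r].
    + exists phi, dphi; split; [exact H1|split; [|now split]].
      intros t; specialize (H2 t); rewrite Hcm in H2; exact H2.
Qed.

(** The profile enters through explicit first and second derivatives, from which
    the total derivative functions of phi and of phi (x + c t) are computed. *)
Lemma traveling_wave_of_profile (a delta p tau1 tau2 c Uminus Uplus : R)
  (phi dphi ddphi : R -> R) :
  0 < c ->
  (forall t, is_derive phi t (dphi t)) -> (forall t, is_derive dphi t (ddphi t)) ->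
  (forall xi, ddphi (xi - c * tau1) - c * dphi xi - delta * phi xi
     + birth a p (phi (xi - c * tau2)) = 0) ->
  is_lim phi m_infty Uminus -> is_lim phi p_infty Uplus ->
  traveling_wave a delta p tau1 tau2 c Uminus Uplus phi (fun t x => phi (x + c * t)).
Proof.
  intros Hc H1 H2 Heq Hm Hp.
  assert (D1 : forall w x, Derive (fun y => phi (y + w)) x = dphi (x + w)).
  { intros w x; apply is_derive_unique, is_derive_shift, H1. }
  assert (D2 : forall w x,
    is_derive (Derive (fun y => phi (y + w))) x (ddphi (x + w))).
  { intros w x; apply (is_derive_ext (fun y => dphi (y + w)));
      [intros y; now rewrite D1|apply is_derive_shift, H2]. }
  assert (Dt : forall t x, is_derive (fun s => phi (x + c * s)) t (c * dphi (x + c * t))).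
  { intros t x; evar_last.
    - apply (is_derive_comp phi (fun s => x + c * s)); [apply H1|].
      auto_derive; [exact I|reflexivity].
    - unfold scal; simpl; unfold mult; simpl; ring. }
  assert (E1 : forall x, Derive phi x = dphi x) by (intros x; apply is_derive_unique, H1).
  assert (E2 : forall x, is_derive (Derive phi) x (ddphi x)).
  { intros x; apply (is_derive_ext dphi); [intros y; now rewrite E1|apply H2]. }
  split; [exact Hc|split; [reflexivity|split; [split; [|split]|split; [|split; [|now split]]]]].
  - intros t x; eexists; apply Dt.
  - intros t x; split.
    + eexists; apply is_derive_shift, H1.
    + eexists; apply D2.
  - intros t x.
    change (Derive (fun s : R => phi (x + c * s)) t =
      Derive (Derive (fun y : R => phi (y + c * (t - tau1)))) x
      - delta * phi (x + c * t) + birth a p (phi (x + c * (t - tau2)))).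
    rewrite (is_derive_unique (fun s : R => phi (x + c * s)) _ _ (Dt t x)).
    rewrite (is_derive_unique (Derive (fun y : R => phi (y + c * (t - tau1)))) _ _
               (D2 (c * (t - tau1)) x)).
    specialize (Heq (x + c * t)).
    replace (x + c * (t - tau1)) with (x + c * t - c * tau1) by ring.
    replace (x + c * (t - tau2)) with (x + c * t - c * tau2) by ring.
    lra.
  - intros x; split; eexists; [apply H1|apply E2].
  - intros xi.
    change (Derive_n phi 2 (xi - c * tau1)) with (Derive (Derive phi) (xi - c * tau1)).
    rewrite E1, (is_derive_unique (Derive phi) _ _ (E2 (xi - c * tau1))); apply Heq.
Qed.

Theorem corollary3p10 (a delta p c : R)
  (ha : 0 < a) (hdelta : 0 < delta) (hp : 0 < p)
  (hpd : 1 < p / delta <= exp 1)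
  (hc : 2 * sqrt p < c) :
  exists taustar : R, 0 < taustar /\
    forall tau1 tau2 : R,
      0 < tau1 < taustar -> 0 < tau2 < taustar ->
      exists (phi : R -> R) (u : R -> R -> R),
        traveling_wave a delta p tau1 tau2 c U0 (Ue a delta p) phi u.
Proof.
  assert (Hc : 0 < c) by (generalize (sqrt_pos p); lra).
  destruct (small_delay_profile delta p c hdelta hpd hc) as [rho [Hrho Hwave]].
  assert (Hscale : forall tau, 0 < tau < rho / c -> 0 < c * tau < rho).
  { intros tau [H0 H1]; split; [now apply Rmult_lt_0_compat|].
    replace rho with (c * (rho / c)) by (field; lra).
    now apply Rmult_lt_compat_l. }
  exists (rho / c); split; [now apply Rdiv_lt_0_compat|].
  intros tau1 tau2 H1 H2.
  destruct (Hwave (c * tau1) (c * tau2) (Hscale _ H1) (Hscale _ H2))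
    as [theta [dtheta [D1 [D2 [Lm Lp]]]]].
  set (U := Ue a delta p).
  exists (fun t => U * theta t), (fun t x => U * theta (x + c * t)).
  apply (traveling_wave_of_profile a delta p tau1 tau2 c U0 U (fun t => U * theta t)
    (fun t => U * dtheta t) (fun t => U *
      (c * dtheta (t + c * tau1) + delta * theta (t + c * tau1)
       - p * theta (t + (c * tau1 - c * tau2))
         * exp (- ln (p / delta) * theta (t + (c * tau1 - c * tau2)))))).
  - exact Hc.
  - intros t; apply is_derive_scal, D1.
  - intros t; apply is_derive_scal, D2.
  - intros xi; unfold birth.
    replace (xi - c * tau1 + c * tau1) with xi by ring.
    replace (xi - c * tau1 + (c * tau1 - c * tau2)) with (xi - c * tau2) by ring.
    replace (- a * (U * theta (xi - c * tau2))) with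
      (- ln (p / delta) * theta (xi - c * tau2)) by (unfold U, Ue; field; lra).
    ring.
  - evar_last; [exact (is_lim_scal_l theta U m_infty 0 Lm)|].
    simpl; f_equal; unfold U0; ring.
  - evar_last; [exact (is_lim_scal_l theta U p_infty 1 Lp)|].
    simpl; f_equal; ring.
Qed.
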